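(* Let $L$ be a finite-dimensional $n$-step nilpotent Lie superalgebra over a field $\mathbb{F}$ with $n\geq 3$. If there exists a non-trivial anti-superderivation $T\in\operatorname{AntiDer}(L)$ such that $T(L^1)\subseteq Z(L)$, then $L$ admits pure local anti-superderivations, i.e. there exists a local anti-superderivation of $L$ that is not an anti-superderivation of $L$.
   Context: A Lie superalgebra over $\mathbb{F}$ is a $\mathbb{Z}_2$-graded vector space $L=L_{\bar 0}\oplus L_{\bar 1}$ with a bilinear bracket satisfying $[L_\alpha,L_\beta]\subseteq L_{\alpha+\beta}$ and, for all $x\in L_\alpha$, $y\in L_\beta$, $z\in L$ with $\alpha,\beta\in\mathbb{Z}_2$ (in the first identity $x,y$ are homogeneous of degrees $|x|=\alpha$, $|y|=\beta$), $[x,y]=-(-1)^{|x||y|}[y,x]$ and $[x,[y,z]]=[[x,y],z]+(-1)^{|x||y|}[y,[x,z]]$. Lower central series: $L^0=L$, $L^1=[L,L]$, $L^k=[L,L^{k-1}]$ for $k\geq 1$. $L$ is nilpotent if $L^n=0$ for some positive integer $n$; the smallest such positive integer $n$ is the nilpotency index, and $L$ is then called $n$-step nilpotent. The center is $Z(L)=\{x\in L\mid [x,y]=0 \text{ for all } y\in L\}$. A linear map $T:L\to L$ that is homogeneous of degree $|T|=\alpha\in\mathbb{Z}_2$ (i.e. $T(L_\beta)\subseteq L_{\alpha+\beta}$) is an anti-superderivation of degree $\alpha$ if $T([x,y])=-[T(x),y]-(-1)^{|T||x|}[x,T(y)]$ for all homogeneous $x\in L$ and all $y\in L$. Let $\operatorname{AntiDer}_\alpha(L)$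 be the set of these, and $\operatorname{AntiDer}(L)=\operatorname{AntiDer}_{\bar 0}(L)\oplus\operatorname{AntiDer}_{\bar 1}(L)$; the elements of $\operatorname{AntiDer}(L)$ are the anti-superderivations of $L$. An anti-superderivation $T$ is trivial if $T(x)=0$ for all $x\in L$, and non-trivial otherwise. A linear map $\Delta:L\to L$ is a local anti-superderivation if for every $x\in L$ there is an anti-superderivation $T_x\in\operatorname{AntiDer}(L)$ (depending on $x$) with $\Delta(x)=T_x(x)$. A pure local anti-superderivation is a local anti-superderivation that is not an anti-superderivation. *)

(* Defs.v *)
From HB Require Import structures.
From mathcomp Require Import all_boot all_order all_algebra.

Set Implicit Arguments.
Unset Strict Implicit.
Unset Printing Implicit Defensive.

Import GRing.Theory.
Local Open Scope ring_scope.

(* In a sign (-1) ^+ (a * b)%R with a, b : 'Z_2, the product is taken in 'Z_2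
   and then read as the natural number 0 or 1. *)
Record lieSuperalgebra (F : fieldType) := LieSuperalgebra {
  lsa_sort :> vectType F;
  gr : 'Z_2 -> {vspace lsa_sort};
  br : {bilinear lsa_sort -> lsa_sort -> lsa_sort};
  gr_full : (gr 0%R + gr 1%R = fullv)%VS;
  gr_disjoint : (gr 0%R :&: gr 1%R = 0)%VS;
  br_gr : forall (a b : 'Z_2) (x y : lsa_sort),
    x \in gr a -> y \in gr b -> br x y \in gr (a + b);
  br_skew : forall (a b : 'Z_2) (x y : lsa_sort),
    x \in gr a -> y \in gr b ->
    br x y = - ((-1) ^+ (a * b)%R *: br y x);
  br_jacobi : forall (a b : 'Z_2) (x y z : lsa_sort),
    x \in gr a -> y \in gr b ->
    br x (br y z) = br (br x y) z + (-1) ^+ (a * b)%R *: br y (br x z)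
}.

Section LieSuperalgebraTheory.

Variables (F : fieldType) (L : lieSuperalgebra F).
Implicit Types (U V W : {vspace L}) (T D : 'End(L)) (a b : 'Z_2) (x y z : L).

(* The span of the brackets [u, v] with u in U, v in V: brvP below. *)
Definition brv U V : {vspace L} :=
  <<[seq br L u v | u <- vbasis U, v <- vbasis V]>>%VS.

Lemma memv_br U V x y : x \in U -> y \in V -> br L x y \in brv U V.
Proof.
move=> /coord_vbasis-> /coord_vbasis->.
rewrite linear_sumlz; apply: memv_suml => i _ /=.
rewrite linear_sumr; apply: memv_suml => j _ /=.
rewrite linearZl_LR linearZr_LR !memvZ // memv_span //.
by apply/allpairsP; exists ((vbasis U)`_i, (vbasis V)`_j); rewrite !memt_nth.
Qed.

Lemma brvP U V W :
  reflect (forall x y, x \in U -> y \in V -> br L x y \in W) (brv U V <= W)%VS.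
Proof.
apply: (iffP idP) => [sUVW x y Ux Vy | sUVW].
  by rewrite (subvP sUVW) ?memv_br.
apply/span_subvP => _ /allpairsP[[u v] /= [Uu Vv ->]].
by rewrite sUVW ?vbasis_mem.
Qed.

Fixpoint lcs (k : nat) : {vspace L} :=
  if k is k'.+1 then brv fullv (lcs k') else fullv.

Definition nilpotent_step (n : nat) : Prop :=
  [/\ (0 < n)%N, lcs n = 0%VS
    & forall m : nat, (0 < m)%N -> lcs m = 0%VS -> (n <= m)%N].

Definition in_center x : Prop := forall y, br L x y = 0.

Definition homogeneous_map a T : Prop :=
  forall b x, x \in gr L b -> T x \in gr L (a + b).

Definition antiSuperder_deg a T : Prop :=
  homogeneous_map a T /\
  forall b x y, x \in gr L b ->
    T (br L x y) = - br L (T x) y - (-1) ^+ (a * b)%R *: br L x (T y).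

Definition antiSuperder T : Prop :=
  exists T0 T1 : 'End(L),
    [/\ antiSuperder_deg 0 T0, antiSuperder_deg 1 T1 & T = T0 + T1].

Definition local_antiSuperder D : Prop :=
  forall x, exists2 T, antiSuperder T & D x = T x.

Definition pure_local_antiSuperder D : Prop :=
  local_antiSuperder D /\ ~ antiSuperder D.

End LieSuperalgebraTheory.

Arguments lcs {F} L k.
Arguments nilpotent_step {F} L n.

(* Main.v *)
(* Let i >= 1 be minimal with [L^(n-2-i), L^i] <> 0.  By minimality the mixed
   terms of the Leibniz rule vanish for D = ad b_(i-1) .. ad b_1 ad a, with a in
   L^(n-2-i) and all factors homogeneous, so D is a superderivation; it maps L^1
   into the central L^(n-1), and suitable factors make it nonzero on L^1.  Let q
   be a graded projection onto L^1.  Then T = D - 2 D q is an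
   anti-superderivation, and Delta = - D q agrees with T on L^1 and, at a vector
   outside L^1, with some map from L/L^1 to L^(n-1), which is an
   anti-superderivation as well.  But an anti-superderivation with central
   values kills L^1, and Delta does not. *)
Require Import Defs.
From HB Require Import structures.
From mathcomp Require Import all_boot all_order all_algebra.
From mathcomp Require Import zify.

Set Implicit Arguments.
Unset Strict Implicit.
Unset Printing Implicit Defensive.

Import GRing.Theory.
Local Open Scope ring_scope.

(** * Parities and homogeneous components *)

Lemma Z2_cases (a : 'Z_2) : a = 0 \/ a = 1.
Proof. by case: a => [[|[|a]] // lta]; [left | right]; apply: val_inj. Qed.

Lemma signZ2D (R : nzRingType) (a b : 'Z_2) :
  (-1) ^+ (a + b)%R = (-1) ^+ a * (-1) ^+ b :> R.
Proof.
rewrite -exprD.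
by case: (Z2_cases a) => ->; case: (Z2_cases b) => ->; rewrite // sqrrN expr1n.
Qed.

Section LieSuperalgebraTheory.

Variables (F : fieldType) (L : lieSuperalgebra F).
Implicit Types (U V W : {vspace L}) (T D A : 'End(L)) (a b d : 'Z_2).
Implicit Types (x y z u v w : L).

Definition par a : 'End(L) := daddv_pi (gr L a) (gr L (a + 1)).

Lemma gr_capC a : (gr L a :&: gr L (a + 1)%R = 0)%VS.
Proof.
case: (Z2_cases a) => ->; first by rewrite add0r gr_disjoint.
by rewrite capvC (_ : 1 + 1 = 0 :> 'Z_2) ?gr_disjoint //; apply: val_inj.
Qed.

Lemma par_mem a x : par a x \in gr L a.
Proof. exact: memv_pi. Qed.

Lemma par_sum x : x = par 0 x + par 1 x.
Proof.
rewrite /par add0r (_ : 1 + 1 = 0 :> 'Z_2); last exact: val_inj.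
by rewrite daddv_pi_add ?gr_disjoint // gr_full memvf.
Qed.

Lemma par_id a x : x \in gr L a -> par a x = x.
Proof. exact/daddv_pi_id/gr_capC. Qed.

Lemma par_neq a b x : a != b -> x \in gr L b -> par a x = 0.
Proof.
move=> neq_ab xb; have := par_sum x.
case: (Z2_cases a) neq_ab => ->; case: (Z2_cases b) xb => -> // xb _;
  rewrite [in X in _ = X -> _](par_id xb).
- by rewrite -{1}[x]add0r => /addIr.
- by rewrite -{1}[x]addr0 => /addrI.
Qed.

Lemma comp3_lfunE (f g h : 'End(L)) x : (f \o g \o h)%VF x = f (g (h x)).
Proof. by rewrite !comp_lfunE. Qed.

(** * Graded subspaces and the lower central series *)

Definition graded U := forall a x, x \in U -> par a x \in U.

Lemma graded_fullv : graded fullv.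
Proof. by move=> a x _; rewrite memvf. Qed.

Lemma linear_neq0_par (f : {linear L -> L}) x :
  f x != 0 -> exists a, f (par a x) != 0.
Proof.
rewrite {1}[x]par_sum linearD /=.
have [->|?] := eqVneq (f (par 0 x)) 0; last by exists 0.
by rewrite add0r; exists 1.
Qed.

(** If [f] killed all brackets of basis vectors it would kill their span. A surviving bracket is
    then refined to homogeneous components, first in [v], then in [u]. *)
Lemma brv_neq0_hom U V (f : {linear L -> L}) z :
    graded U -> graded V -> z \in brv U V -> f z != 0 ->
  exists a b u v, [/\ u \in U, u \in gr L a, v \in V, v \in gr L b
    & f (br L u v) != 0].
Proof.
move=> gU gV UVz fz_neq0.
have: ~~ all [in lker (linfun f)] [seq br L u v | u <- vbasis U, v <- vbasis V].
  apply: contraNN fz_neq0 => /allP/span_subvP/subvP/(_ z UVz).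
  by rewrite memv_ker lfunE.
case/allPn=> _ /allpairsP[[u v] /= [uU vV ->]].
rewrite memv_ker lfunE /= => fuv.
have [b fuv'] := @linear_neq0_par (f \o br L u) v fuv.
have [a fuv2] := @linear_neq0_par (f \o applyr (br L) (par b v)) u fuv'.
exists a, b, (par a u), (par b v).
by split; rewrite ?par_mem ?gU ?gV ?vbasis_mem.
Qed.

Lemma brv_hom_ind U V W (f : 'End(L)) :
    graded U -> graded V ->
    (forall a b u v, u \in U -> u \in gr L a -> v \in V -> v \in gr L b ->
      f (br L u v) \in W) ->
  forall z, z \in brv U V -> f z \in W.
Proof.
move=> gU gV fW z; rewrite memv_preim; apply/subvP/brvP => x y xU yV.
rewrite -memv_preim [x]par_sum [y]par_sum !(linearDl, linearDr, linearD) /=.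
by rewrite !memvD // (fW _ _ _ _ _ (par_mem _ _) _ (par_mem _ _)) ?gU ?gV.
Qed.

Lemma graded_brv U V : graded U -> graded V -> graded (brv U V).
Proof.
move=> gU gV c; apply: brv_hom_ind => // a b u v uU ua vV vb.
have uvg := br_gr ua vb; have [->|neq_c] := eqVneq c (a + b).
  by rewrite (par_id uvg) memv_br.
by rewrite (par_neq neq_c uvg) mem0v.
Qed.

Lemma graded_lcs k : graded (lcs L k).
Proof.
elim: k => [|k IHk]; first exact: graded_fullv.
exact: graded_brv graded_fullv IHk.
Qed.

Lemma lcs_brl k x y : y \in lcs L k -> br L x y \in lcs L k.+1.
Proof. by move=> yk; rewrite memv_br ?memvf. Qed.

(** Induction on [p], moving a factor out of [[[u, v], y]] by the Jacobi identity. The shift by one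
    comes from [L^0 = L]. *)
Lemma lcs_br p q x y :
  x \in lcs L p -> y \in lcs L q -> br L x y \in lcs L (p + q).+1.
Proof.
elim: p => [|p IHp] in q x y *; first by move=> _; apply: lcs_brl.
move=> xp yq; have -> : br L x y = linfun (applyr (br L) y) x by rewrite lfunE.
apply: brv_hom_ind xp => [||a b u v _ ua vp vb].
- exact: graded_fullv.
- exact: graded_lcs.
rewrite lfunE /= -[br L (br L u v) y](addrK
  ((-1) ^+ (a * b)%R *: br L v (br L u y))).
rewrite -(br_jacobi _ ua vb) memvB ?memvZ //.
  by apply: lcs_brl (IHp _ _ _ vp yq).
by have := IHp _ _ _ vp (lcs_brl u yq); rewrite addnS.
Qed.

Lemma brv_eq0_sym U V : graded U -> graded V -> brv U V = 0%VS ->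
  forall x y, x \in V -> y \in U -> br L x y = 0.
Proof.
move=> gU gV UV0 x y xV yU.
have br0 a b : br L (par a x) (par b y) = 0.
  rewrite (br_skew (par_mem _ _) (par_mem _ _)).
  suff /eqP-> : br L (par b y) (par a x) == 0 by rewrite scaler0 oppr0.
  by rewrite -memv0 -UV0 memv_br ?gU ?gV.
by rewrite [x]par_sum [y]par_sum !(linearDl, linearDr) /= !br0 !addr0.
Qed.

(** * Leibniz expansion of products of adjoint maps *)

Lemma comp_adE A v x : (A \o linfun (br L v))%VF x = A (br L v x).
Proof. by rewrite !lfunE /= lfunE. Qed.

Lemma comp_ad_br A a b v x y : v \in gr L b -> x \in gr L a ->
  (A \o linfun (br L v))%VF (br L x y) =
  A (br L (br L v x) y) + (-1) ^+ (b * a)%R *: A (br L x (br L v y)).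
Proof.
by move=> vb xa; rewrite comp_adE (br_jacobi _ vb xa) linearD linearZ.
Qed.

(* Peeled from the innermost factor, so that the Leibniz rule is applied to
   the bracket before the outer factors. *)
Inductive adprod : nat -> 'Z_2 -> 'End(L) -> Prop :=
| AdprodNil : adprod 0 0 \1%VF
| AdprodCons k d A b v : adprod k d A -> v \in gr L b ->
    adprod k.+1 (d + b) (A \o linfun (br L v))%VF.

Lemma adprod_homogeneous k d A : adprod k d A -> homogeneous_map d A.
Proof.
elim=> [|{}k {}d {}A b v _ IHA vb] c x xc; first by rewrite add0r lfunE.
by rewrite comp_adE -addrA; apply/IHA/br_gr.
Qed.

Lemma adprod_lcs k d A p x :
  adprod k d A -> x \in lcs L p -> A x \in lcs L (p + k).
Proof.
move=> AkA; elim: AkA p x => [|{}k {}d {}A b v _ IHA vb] p x xp.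
  by rewrite addn0 lfunE.
by rewrite comp_adE addnS -addSn; apply/IHA/lcs_brl.
Qed.

Definition commuting p q :=
  forall x y, x \in lcs L p -> y \in lcs L q -> br L x y = 0.

(** In each Leibniz term [i] factors act on [x] and [k - i] on [y], which gives a bracket of
    [L^(p+i)] with [L^(q+k-i)]. *)
Lemma adprod_br_eq0 k d A p q a x y :
    adprod k d A ->
    (forall i, (i <= k)%N -> commuting (p + i) (q + (k - i))) ->
  x \in lcs L p -> x \in gr L a -> y \in lcs L q -> A (br L x y) = 0.
Proof.
move=> AkA; elim: AkA p q a x y.
  move=> p q a x y com xp _ yq.
  by rewrite lfunE (com 0%N _) ?addn0 ?linear0.
move=> {}k {}d {}A b v _ IHA vb p q a x y com xp xa yq.
rewrite (comp_ad_br _ _ vb xa).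
rewrite (IHA p.+1 q _ _ _ _ (lcs_brl v xp) (br_gr vb xa)) //; last first.
  by move=> i lei; have := com i.+1 lei; rewrite addnS subSS.
rewrite (IHA p q.+1 _ _ _ _ xp xa (lcs_brl v yq)) ?scaler0 ?addr0 //.
by move=> i lei; have := com i (leqW lei); rewrite subSn // addnS addSn.
Qed.

(** Only the term with all factors on [u] survives: one with [i < k] factors on [u] has its right
    entry in [L^(k-i)]. *)
Lemma adprod_brl k d A p a u y :
    adprod k d A ->
    (forall i, (i < k)%N -> commuting (p + i) (k - i)) ->
  u \in lcs L p -> u \in gr L a -> A (br L u y) = br L (A u) y.
Proof.
move=> AkA; elim: AkA p a u => [|{}k {}d {}A b v AkA IHA vb] p a u com up ua.
  by rewrite !lfunE.
rewrite (comp_ad_br _ _ vb ua) comp_adE.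
rewrite (adprod_br_eq0 (p := p) (q := 1) AkA _ up ua) ?lcs_brl ?memvf //;
  last first.
  by move=> i lei; have := com i lei; rewrite subSn.
rewrite scaler0 addr0; apply: (IHA p.+1 _ _ _ (lcs_brl v up) (br_gr vb ua)).
by move=> i lti; have := com i.+1 lti; rewrite addnS subSS.
Qed.

Lemma adprod_brr k d A p c u x :
    adprod k d A ->
    (forall i, (i < k)%N -> commuting (k - i) (p + i)) ->
    u \in lcs L p -> x \in gr L c ->
  A (br L x u) = (-1) ^+ (d * c)%R *: br L x (A u).
Proof.
move=> AkA; elim: AkA p u => [|{}k {}d {}A b v AkA IHA vb] p u com up xc.
  by rewrite !lfunE mul0r scale1r.
rewrite (comp_ad_br _ _ vb xc) comp_adE.
have vx1 : br L v x \in lcs L 1 by rewrite lcs_brl ?memvf.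
rewrite (adprod_br_eq0 AkA _ vx1 (br_gr vb xc) up); last first.
  (* Here [i] counts factors acting on the left entry, while [com] counts those on the right; hence
     [k - i]. *)
  move=> i lei; have := com (k - i)%N; rewrite ltnS leq_subr => /(_ isT).
  by rewrite subSn ?leq_subr // subKn.
rewrite add0r (IHA p.+1) ?lcs_brl //; last first.
  by move=> i lti; have := com i.+1 lti; rewrite addnS subSS.
by rewrite scalerA mulrDl signZ2D mulrC.
Qed.


(** * The superderivation with central values on [L^1] *)

(** Each step trades depth of [z] for a factor of [A]: for [z = [v, w]], Jacobi splits [[u, z]] into
    [[[u, v], w]], which [A] kills, and a multiple of [[v, [u, w]]], so [A \o ad v] is nonzero at
    [[u, w]]. *)
Lemma adprod_descend i p q k d A a u z :
    (q + k).+1 = i ->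
    (forall j, (0 < j < i)%N -> commuting (p + i - j) j) ->
    adprod k d A -> u \in lcs L p -> u \in gr L a -> z \in lcs L q.+1 ->
    A (br L u z) != 0 ->
  exists d' A' a' u' z', [/\ adprod i.-1 d' A', u' \in lcs L p, u' \in gr L a',
    z' \in lcs L 1 & A' (br L u' z') != 0].
Proof.
elim: q => [|q IHq] in k d A a u z * => def_i com AkA up ua zq nz.
  by exists d, A, a, u, z; split=> //; rewrite -def_i.
have [b [c [v [w [_ vb wq wc]]]]] :=
  @brv_neq0_hom _ (lcs L q.+1) (A \o br L u) z graded_fullv
    (@graded_lcs _) zq nz.
rewrite /= (br_jacobi _ ua vb) linearD linearZ /=.
rewrite (adprod_br_eq0 (p := p.+1) (q := q.+1) AkA _ _ (br_gr ua vb) wq);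
  first last.
- by have := lcs_br up (memvf v : v \in lcs L 0); rewrite addn0.
(* The two indices add up to [p + i], and [t] stays below [i] because at least one unit of depth has
   gone to the left entry. *)
- move=> j lejk; set t := (q.+1 + (k - j))%N; have := com t.
  have [? <-] : (0 < t < i)%N /\ (p + i - t = p.+1 + j)%N.
    by rewrite /t; clear -def_i lejk; lia.
  exact.
rewrite add0r => nz2.
apply: IHq (AdprodCons AkA vb) up ua wq _; rewrite ?addnS ?addSn // comp_adE.
by apply: contraNneq nz2 => ->; rewrite scaler0.
Qed.

Lemma exists_superder n :
    lcs L n.+3 = 0%VS -> lcs L n.+2 <> 0%VS ->
  exists d D, [/\ homogeneous_map d D,
    forall a x y, x \in gr L a ->
      D (br L x y) = br L (D x) y + (-1) ^+ (d * a)%R *: br L x (D y),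
    forall x, x \in lcs L 1 -> D x \in lcs L n.+2
    & exists2 z, z \in lcs L 1 & D z != 0].
Proof.
move=> lcs0 /eqP lcs_neq0.
pose P i := (0 < i <= n.+1)%N && (brv (lcs L (n.+1 - i)) (lcs L i) != 0%VS).
(* For [i = n + 1] the bracket is [[L, L^(n+1)] = L^(n+2)]. *)
have exP : exists i, P i by exists n.+1; rewrite /P subnn leqnn.
case: (ex_minnP exP) => i /andP[/andP[i_gt0 le_in] nz] min_i.
have brv0 j : (0 < j < i)%N -> brv (lcs L (n.+1 - j)) (lcs L j) = 0%VS.
  case/andP=> j_gt0 ltji; have ltjn := leq_trans ltji le_in.
  apply/eqP; apply: contraLR ltji => nzj.
  by rewrite -leqNgt min_i // /P nzj andbT j_gt0 ltnW.
have comL j : (0 < j < i)%N -> commuting (n.+1 - j) j.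
  by move=> /brv0 br0 x y xU yV; apply/eqP; rewrite -memv0 -br0 memv_br.
have comR j : (0 < j < i)%N -> commuting j (n.+1 - j).
  by move=> /brv0 br0; apply: brv_eq0_sym br0; apply: graded_lcs.
have [p def_p] : {p | p = n.+1 - i}%N by exists (n.+1 - i)%N.
have def_n : (p + i = n.+1)%N by lia.
rewrite -def_p in nz.
have nz1 : \1%VF (vpick (brv (lcs L p) (lcs L i))) != 0.
  by rewrite id_lfunE vpick0.
have [a1 [b [u1 [v [up1 ua1 vi _ nzuv]]]]] :=
  brv_neq0_hom (@graded_lcs p) (@graded_lcs i) (memv_pick _) nz1.
have [d [A [a [u [z [AkA up ua z1 nz2]]]]]] :
  exists d' A' a' u' z', [/\ adprod i.-1 d' A', u' \in lcs L p, u' \in gr L a',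
    z' \in lcs L 1 & A' (br L u' z') != 0].
  (* The descent starts from the empty product and [v] in [L^i], so it collects [i - 1] factors. *)
  apply: (@adprod_descend i p i.-1 0 0 \1%VF) ua1 _ nzuv => //.
  - by rewrite addn0 prednK.
  - by rewrite def_n.
  - exact: AdprodNil.
  - by rewrite prednK.
have arith j : (j < i.-1)%N ->
    (0 < i.-1 - j < i)%N /\ (n.+1 - (i.-1 - j) = p.+1 + j)%N.
  by clear -def_n i_gt0; lia.
have arith2 : ((p + 1).+1 + i.-1 = n.+2)%N by clear -def_n i_gt0; lia.
have lcs_ad k x : x \in lcs L k -> br L u x \in lcs L (p + k).+1.
  exact: lcs_br.
exists (d + a), (A \o linfun (br L u))%VF; split.
- move=> c x xc; rewrite comp_adE -addrA.
  exact/(adprod_homogeneous AkA)/br_gr.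
(* Both [[u, x]] and [[u, y]] lie in [L^(p+1)], so in each of the two terms [A] passes entirely to
   that entry. *)
- move=> c x y xc; rewrite (comp_ad_br _ _ ua xc) !comp_adE.
  rewrite (adprod_brl (p := p.+1) _ AkA _ _ (br_gr ua xc)); first last.
  + by have := lcs_ad 0%N x (memvf x); rewrite addn0.
  + by move=> j /arith[ltj <-]; apply: comL.
  rewrite (adprod_brr (p := p.+1) AkA _ _ xc); first last.
  + by have := lcs_ad 0%N y (memvf y); rewrite addn0.
  + by move=> j /arith[ltj <-]; apply: comR.
  by rewrite scalerA mulrDl signZ2D mulrC.
- move=> x /lcs_ad /(adprod_lcs AkA); rewrite comp_adE.
  by rewrite arith2.
by exists z; rewrite // comp_adE.
Qed.

(** * Anti-superderivations vanishing on brackets *)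

Lemma antiSuperder_deg_antiSuperder d T :
  antiSuperder_deg d T -> antiSuperder T.
Proof.
have anti0 a : antiSuperder_deg a (0 : 'End(L)).
  split=> [b x xb | b x y xb]; rewrite !zero_lfunE ?mem0v //.
  by rewrite linear0l linear0r scaler0 !oppr0 addr0.
case: (Z2_cases d) => -> antiT; first by exists T, 0; rewrite addr0.
by exists 0, T; rewrite add0r.
Qed.

(** Two-sided, since [br_skew] speaks of homogeneous vectors only. *)
Definition central U := forall x y, x \in U -> br L x y = 0 /\ br L y x = 0.

Lemma lcs_central n : lcs L n.+1 = 0%VS -> central (lcs L n).
Proof.
move=> lcs0 x y xn; split; apply/eqP; rewrite -memv0 -lcs0.
  by have := lcs_br xn (memvf y : y \in lcs L 0); rewrite addn0.
exact: lcs_brl.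
Qed.

(** Every term of the anti-Leibniz rule is zero. What remains is to split [T] by degree, and
    gradedness of [U] keeps both parts central-valued. *)
Lemma antiSuperder_central U T :
    graded U -> central U -> (forall x, T x \in U) ->
    (forall x, x \in lcs L 1 -> T x = 0) ->
  antiSuperder T.
Proof.
move=> gU cU TU T1.
have par1 a x : x \in lcs L 1 -> par a x \in lcs L 1 by apply: graded_lcs.
(* The block of [T] from degree [b] to degree [a]: diagonal blocks form the even part, the others
   the odd part. *)
pose C (a b : 'Z_2) := (par a \o T \o par b)%VF.
have CE a b x : C a b x = par a (T (par b x)) by rewrite comp3_lfunE.
have C_U a b x : C a b x \in U by rewrite CE gU.
have C_1 a b x : x \in lcs L 1 -> C a b x = 0.
  by move=> x1; rewrite CE T1 ?linear0 ?par1.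
have anti d (S : 'End(L)) : homogeneous_map d S ->
    (forall x, S x \in U) -> (forall x, x \in lcs L 1 -> S x = 0) ->
    antiSuperder_deg d S.
  move=> homS SU S1; split=> // b x y xb.
  rewrite S1 ?lcs_brl ?memvf // !(cU _ _ (SU _)).1 !(cU _ _ (SU _)).2.
  by rewrite scaler0 oppr0 addr0.
have hom a b : homogeneous_map (a - b) (C a b).
  move=> c x xc; rewrite CE; have [eq_bc|neq_bc] := eqVneq b c.
    by rewrite -eq_bc subrK par_mem.
  by rewrite (par_neq neq_bc xc) !linear0 mem0v.
have sum2 (f g : 'End(L)) d : homogeneous_map d f -> homogeneous_map d g ->
    homogeneous_map d (f + g).
  by move=> homf homg c x xc; rewrite lfunE memvD ?homf ?homg.
exists (C 0 0 + C 1 1), (C 1 0 + C 0 1); split.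
- apply: anti => [|x|x x1]; last by rewrite lfunE /= !C_1 ?addr0.
    by apply: sum2; [have := hom 0 0 | have := hom 1 1]; rewrite subrr.
  by rewrite lfunE /= memvD.
- apply: anti => [|x|x x1]; last by rewrite lfunE /= !C_1 ?addr0.
    apply: sum2; first by have := hom 1 0; rewrite subr0.
    by have := hom 0 1; rewrite (_ : 0 - 1 = 1 :> 'Z_2) //; apply: val_inj.
  by rewrite lfunE /= memvD.
apply/lfunP => x; rewrite !lfunE /= !lfunE /= !CE.
rewrite {1}[x]par_sum linearD /=.
rewrite {1}[T (par 0 x)]par_sum {1}[T (par 1 x)]par_sum.
by rewrite [par 0 (T (par 1 x)) + _]addrC addrACA.
Qed.

(** * Separating maps and graded projections *)

(** [C] multiplies [z] by the coordinate of [u - projv U u] along [y], the nonzero residue of [x]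
    modulo [U]. *)
Lemma exists_linear_sep U x z :
  x \notin U -> exists C : 'End(L), [/\ C x = z, forall u, u \in U -> C u = 0
    & forall y, C y \in <[z]>%VS].
Proof.
move=> xU; set y := x - projv U x.
have y_neq0 : y != 0.
  by apply: contraNneq xU => /eqP; rewrite subr_eq0 => /eqP->; apply: memv_proj.
pose X : 1.-tuple L := [tuple y]; pose f : 'End(L) := \1%VF - projv U.
have fE u : f u = u - projv U u by rewrite !lfunE /= lfunE /= lfunE.
have [g gE] : exists g : 'End(L), forall u, g u = coord X 0 u *: z.
  have lin : linear (fun u => coord X 0 u *: z : L).
    by move=> c u v; rewrite linearP scalerDl scalerA.
  pose h := GRing.isLinear.Build _ _ _ _ _ lin.
  pose hL : {linear L -> L} := HB.pack (fun u => coord X 0 u *: z : L) h.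
  by exists (linfun hL) => u; rewrite lfunE.
exists (g \o f)%VF; split=> [|u uU|u]; rewrite comp_lfunE gE fE.
- have freeX : free X by rewrite seq1_free.
  by rewrite (coord_free 0 0 freeX) scale1r.
- by rewrite projv_id // subrr !linear0 scale0r.
- by rewrite memvZ ?memv_line.
Qed.

(** [projv U] may mix degrees; its diagonal blocks do not, and they still fix the graded subspace
    [U]. *)
Lemma exists_graded_proj U : graded U ->
  exists q : 'End(L), [/\ homogeneous_map 0 q, forall x, q x \in U
    & forall x, x \in U -> q x = x].
Proof.
move=> gU.
exists ((par 0 \o projv U \o par 0) + (par 1 \o projv U \o par 1))%VF.
have qE x : ((par 0 \o projv U \o par 0) + (par 1 \o projv U \o par 1))%VF x =
    par 0 (projv U (par 0 x)) + par 1 (projv U (par 1 x)).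
  by rewrite lfunE; congr (_ + _); apply: comp3_lfunE.
split=> [c x xc|x|x xU]; rewrite qE.
- rewrite add0r; case: (Z2_cases c) xc => -> xc.
    have -> : par 1 x = 0 by apply: par_neq xc.
    by rewrite (linear0 (projv U)) (linear0 (par 1)) addr0 par_mem.
  have -> : par 0 x = 0 by apply: par_neq xc.
  by rewrite (linear0 (projv U)) (linear0 (par 0)) add0r par_mem.
- by apply: memvD; apply/gU/memv_proj.
- have qx a : par a (projv U (par a x)) = par a x.
    by rewrite projv_id ?gU // par_id ?par_mem.
  by rewrite !qx -par_sum.
Qed.

(** * Central-valued anti-superderivations, and the passage from superderivations *)

(** On homogeneous [x], [T0 x] and [T1 x] are the homogeneous components of [T x], so they lie in
    the graded [U]. Centrality then annihilates the right-hand sides of both anti-Leibniz rules. *)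
Lemma antiSuperder_central_bracket U T :
    graded U -> central U -> antiSuperder T -> (forall x, T x \in U) ->
  forall x, x \in lcs L 1 -> T x = 0.
Proof.
move=> gU cU [T0 [T1 [[hom0 anti0] [hom1 anti1] defT]]] TU.
have homU b x : x \in gr L b -> T0 x \in U /\ T1 x \in U.
  move=> xb; have gT0 := hom0 _ _ xb; have gT1 := hom1 _ _ xb.
  rewrite add0r in gT0; have neqb : b != 1 + b by case: (Z2_cases b) => ->.
  have defx : T x = T0 x + T1 x by rewrite defT lfunE.
  split.
    rewrite -(par_id gT0) -[par b (T0 x)]addr0.
    rewrite -(par_neq neqb gT1) -linearD -defx.
    exact: gU.
  rewrite -(par_id gT1) -[par _ (T1 x)]add0r.
  rewrite -[0](par_neq (_ : 1 + b != b) gT0) 1?eq_sym // -linearD -defx.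
  exact: gU.
have allU x : T0 x \in U /\ T1 x \in U.
  have [a0 a1] := homU _ _ (par_mem 0 x).
  have [b0 b1] := homU _ _ (par_mem 1 x).
  by rewrite [x]par_sum !linearD !memvD.
move=> x x1; apply/eqP; rewrite -memv0.
apply: brv_hom_ind x1; [exact: graded_fullv | exact: graded_fullv |].
move=> a b u v _ ua _ _; rewrite defT lfunE /=.
rewrite (anti0 _ _ _ ua) (anti1 _ _ _ ua).
rewrite !(cU _ _ (allU _).1).1 !(cU _ _ (allU _).1).2.
rewrite !(cU _ _ (allU _).2).1 !(cU _ _ (allU _).2).2.
by rewrite !scaler0 !oppr0 !addr0 mem0v.
Qed.

(** On brackets [q] is the identity, so the map equals [- D] there, which supplies the sign. Inside
    a bracket the correction [2 D q] is central and disappears. *)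
Lemma antiSuperder_superder d D q U :
    homogeneous_map d D ->
    (forall a x y, x \in gr L a ->
      D (br L x y) = br L (D x) y + (-1) ^+ (d * a)%R *: br L x (D y)) ->
    homogeneous_map 0 q ->
    (forall x, x \in lcs L 1 -> q x = x) ->
    central U -> (forall x, D (q x) \in U) ->
  antiSuperder_deg d (D - (D \o q)%VF *+ 2).
Proof.
move=> homD derD homq q1 cU DqU.
have TE x : (D - (D \o q)%VF *+ 2) x = D x - D (q x) *+ 2.
  by rewrite lfunE /= opp_lfunE mulr2n lfunE /= comp_lfunE.
split=> [c x xc | c x y xc]; rewrite !TE.
  have qx := homq _ _ xc; rewrite add0r in qx.
  by rewrite memvB ?homD // mulr2n memvD ?homD.
have UTx u : D (q u) *+ 2 \in U by rewrite mulr2n memvD.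
rewrite linearBl linearBr /= (cU _ _ (UTx _)).1 (cU _ _ (UTx _)).2 !subr0.
rewrite q1 ?lcs_brl ?memvf // (derD _ _ _ xc).
by rewrite mulr2n opprD addrA subrr add0r opprD.
Qed.

End LieSuperalgebraTheory.

(** * Construction of the pure local anti-superderivation *)

Theorem theorem4p6 (F : fieldType) (L : lieSuperalgebra F) (n : nat) :
  (3 <= n)%N ->
  nilpotent_step L n ->
  (exists T : 'End(L),
    [/\ antiSuperder T,
        ~ (forall x : L, T x = 0)
      & forall x : L, x \in lcs L 1 -> in_center (T x)]) ->
  exists D : 'End(L), pure_local_antiSuperder D.
Proof.
case: n => [|[|[|n]]] // _ [_ lcs0 min_n] _.
(* The nilpotency index now reads [n.+3], so [L^(n+2)] is the last nonzero term. *)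
have lcs_neq0 : lcs L n.+2 <> 0%VS.
  by move/(min_n n.+2 (ltn0Sn _)); rewrite ltnn.
have [d [D [homD derD D1 [z z1 Dz]]]] := exists_superder lcs0 lcs_neq0.
have cU := lcs_central lcs0; have gU := @graded_lcs _ L n.+2.
have [q [homq q_in q_id]] := exists_graded_proj (@graded_lcs _ L 1).
have DqU x : D (q x) \in lcs L n.+2 by apply: D1.
have DE x : (- (D \o q)%VF) x = - D (q x) by rewrite opp_lfunE comp_lfunE.
exists (- (D \o q)%VF); split=> [x | antiD].
  have [x1|x_notin] := boolP (x \in lcs L 1).
    have antiT := antiSuperder_superder homD derD homq q_id cU DqU.
    exists (D - (D \o q)%VF *+ 2).
      exact: antiSuperder_deg_antiSuperder antiT.
    rewrite DE mulr2n !lfunE /= opp_lfunE lfunE /= !comp_lfunE q_id //.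
    by rewrite opprD addrA subrr add0r.
  (* The range of [C] is within the line of [- D (q x)], hence in the central [L^(n+2)]. *)
  have [C [Cx C1 Cz]] := exists_linear_sep (- D (q x)) x_notin.
  exists C; last by rewrite DE.
  apply: antiSuperder_central gU cU _ C1 => y.
  by apply: subvP (Cz y); rewrite -memvE memvN.
have DU x : (- (D \o q)%VF) x \in lcs L n.+2 by rewrite DE memvN.
have := antiSuperder_central_bracket gU cU antiD DU z1.
by rewrite DE q_id // => /eqP; rewrite oppr_eq0 (negPf Dz).
Qed.
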